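(* Let $A$ be an algebra over an infinite commutative domain $R$ whose group of units $U(A)$ satisfies a Laurent polynomial identity over $R$. Then, for all $a,b,c\in A$ with $a^2=bc=0$, $bacA$ is a nil right ideal of bounded exponent.
   Context: Algebras are associative with unit; $U(A)$ is the group of units of $A$. Let $F=\langle x_1,\dots,x_m\rangle$ be a free group. A Laurent polynomial identity (LPI) over $R$ for $U(A)$ is a non-zero element $P$ of the group ring $RF$ such that $P(c_1,\dots,c_m)=0$ in $A$ for all $c_1,\dots,c_m\in U(A)$. Throughout, an LPI is assumed to be of the form $P=a_1+a_2w_2+\cdots+a_tw_t$ with $t\ge 2$, all $a_i\in R$ non-zero (in particular $a_1\neq 0$), and $w_2,\dots,w_t$ distinct non-trivial words in $F$, such that each $w_i$ has non-zero sum of exponents in at least one of the variables $x_j$. A nil (right) ideal $I$ has bounded exponent if there is an integer $m$ such that for every $a\in I$, $a^i=0$ for some $i\le m$.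
   Formalization: The algebra A is additionally assumed to be R-torsion-free (rx = 0 implies r = 0 or x = 0); without this the claim fails, e.g. for R = Z, A = M_2(F_2), identity 1 - x^6, a = e12, b = c = e21. *)

(* Defs.v *)
From HB Require Import structures.
From mathcomp Require Import all_boot all_order all_algebra finmap.
From mathcomp Require Import monalg.
From mathcomp Require Import classical_sets cardinality.

Set Implicit Arguments.
Unset Strict Implicit.
Unset Printing Implicit Defensive.

Import GRing.Theory.
Local Open Scope ring_scope.

(** An element of the free group on [x_0, .., x_(m-1)] is given by its reduced
    word. The letter [(j, false)] stands for [x_j], and [(j, true)] for its
    inverse. *)
Definition letter (m : nat) : Type := ('I_m * bool)%type.

Definition inv_letter m (l : letter m) : letter m := (l.1, ~~ l.2).

Definition reduced m (w : seq (letter m)) : bool :=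
  sorted (fun l1 l2 : letter m => l2 != inv_letter l1) w.

Record free_group (m : nat) :=
  FreeGroup { fgword : seq (letter m); _ : reduced fgword }.

HB.instance Definition _ m := [isSub for @fgword m].
HB.instance Definition _ m := [Choice of free_group m by <:].

Definition fg1 m : free_group m := @FreeGroup m [::] isT.

Definition exponent_sum m (w : free_group m) (j : 'I_m) : int :=
  \sum_(l <- fgword w | l.1 == j) (-1) ^+ l.2.

Definition word_eval (B : unitRingType) m (c : 'I_m -> B) (w : free_group m) : B :=
  \prod_(l <- fgword w) (if l.2 then (c l.1)^-1 else c l.1).

(** The group ring [R F] is the free [R]-module with basis [F]. Only this module
    structure is needed to speak of Laurent polynomials and of their values. *)
Notation laurent R m := {malg R[free_group m]}.

Definition laurent_eval (R : idomainType) (A : unitAlgType R) m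
    (c : 'I_m -> A) (P : laurent R m) : A :=
  \sum_(w <- msupp P) P@_w *: word_eval c w.

(** [P = a_1 + a_2 w_2 + ... + a_t w_t] with [t >= 2], every [a_i] nonzero, and
    the [w_i] distinct nontrivial words, each having a nonzero exponent sum in
    some variable: the [w_i] together with [1] are the support of [P]. *)
Definition LPI_form (R : idomainType) m (P : laurent R m) : Prop :=
  [/\ P@_(fg1 m) != 0,
      (2 <= #|` msupp P|)%N
    & forall w, w \in msupp P -> w != fg1 m ->
        exists j : 'I_m, exponent_sum w j != 0].

Definition is_LPI (R : idomainType) (A : unitAlgType R) m (P : laurent R m) : Prop :=
  [/\ P != 0,
      LPI_form P
    & forall c : 'I_m -> A,
        (forall j, c j \is a GRing.unit) -> laurent_eval c P = 0].

Definition units_satisfy_LPI (R : idomainType) (A : unitAlgType R) : Prop :=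
  exists (m : nat) (P : laurent R m), is_LPI A P.

(** Without this property the nilpotency result below fails. The ring of
    two-by-two matrices over the field with two elements is an algebra over the
    integers whose units satisfy [1 - x ^ 6]; with [a = e12] and [b = c = e21],
    one has [a ^ 2 = b c = 0], but [b a c e12 = e22] is a nonzero idempotent. *)
Definition torsion_free (R : idomainType) (A : lmodType R) : Prop :=
  forall (r : R) (x : A), r *: x = 0 -> r = 0 \/ x = 0.

Definition right_ideal (B : nzRingType) (I : set B) : Prop :=
  [/\ I 0,
      forall x y, I x -> I y -> I (x - y)
    & forall x y, I x -> I (x * y)].

Definition nil_bounded_exponent (B : nzRingType) (I : set B) : Prop :=
  exists n : nat, forall x, I x -> exists2 i : nat, (i <= n)%N & x ^+ i = 0.

Definition principal_right_ideal (B : nzRingType) (z : B) : set B :=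
  [set y | exists x : B, y = z * x]%classic.

(* Main.v *)
Require Import Defs.
From HB Require Import structures.
From mathcomp Require Import all_boot all_order all_algebra finmap.
From mathcomp Require Import monalg zify.
From mathcomp Require Import classical_sets cardinality.

Import GRing.Theory.
Local Open Scope ring_scope.

(** Substituting suitable powers of a single unit [u] for the variables of a
    Laurent polynomial identity turns every nontrivial word of its support into
    a nonzero power of [u], so the coefficient of the trivial word survives: all
    units of [A] are roots of one nonzero polynomial [g] over [R]
    ([LPI_units_algebraic]). If moreover [g] vanishes on a whole line [u + r v]
    with [r] in [R], then, [R] being infinite and [A] torsion-free, the
    coefficient of the top power of [r] vanishes, that is, [v ^+ n = 0] with [n]
    the degree of [g] ([annihilated_line_nilpotent]).

    Elements of square zero provide such lines. For [d] in [A], the element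
    [e = c d b] has square zero because [b c = 0], so that
    [(1 + r a) (1 + e) = (1 + e) + r a (1 + e)] is a unit for every [r], and hence
    [(a (1 + e)) ^+ n = 0]. Since [a (1 + e) a = a e a], multiplying by [a] on
    the right yields [(a e) ^+ n a = 0], hence [(a e) ^+ n.+1 = 0]. Finally
    [a e = (a c d) b] and [b a c d = b (a c d)] differ by a cyclic rotation,
    which costs one more power: [(b a c d) ^+ n.+2 = 0], where [n] depends on
    [g] only. *)

Lemma comm_poly_alg (R : idomainType) (A : unitAlgType R) (p : {poly A})
    (r : R) :
  comm_poly p (r%:A : A).
Proof. by rewrite /comm_poly mulr_algl mulr_algr. Qed.

(** The usual bound on the number of roots holds in [{poly A}], although [A] is
    neither commutative nor a domain, because the roots considered are scalars:
    they are central, so that evaluation at them is multiplicative, and the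
    difference of two distinct ones is not a zero divisor. *)
Lemma root_alg_eq0 (R : idomainType) (A : unitAlgType R) (p : {poly A})
    (rs : seq R) :
  torsion_free A -> uniq rs -> (size p <= size rs)%N ->
  (forall r, r \in rs -> p.[r%:A : A] = 0) -> p = 0.
Proof.
move=> tfA; elim: rs p => [|r rs IHrs] p /=.
  by move=> _ + _; rewrite leqn0 size_poly_eq0 => /eqP.
case/andP=> r_rs uniq_rs le_p p_rs.
have /factor_theorem[q Dp] : root p r%:A.
  by apply/rootP/p_rs; rewrite mem_head.
have [q0 | q_neq0] := eqVneq q 0; first by rewrite Dp q0 mul0r.
have le_q : (size q <= size rs)%N.
  by move: le_p; rewrite Dp size_Mmonic ?monicXsubC // size_XsubC addn2 ltnS.
rewrite Dp (IHrs q) ?mul0r // => s s_rs.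
have: (s - r) *: q.[s%:A] = 0.
  rewrite -(p_rs s) ?inE ?s_rs ?orbT // Dp hornerM_comm ?hornerXsubC;
    last exact: comm_poly_alg.
  by rewrite -scalerBl -scalerAr mulr1.
case/tfA=> // /eqP; rewrite subr_eq0 => /eqP s_r.
by rewrite -s_r s_rs in r_rs.
Qed.

Lemma size_affine_exp (B : nzRingType) (u v : B) n :
  (size ((u%:P + v%:P * 'X) ^+ n) <= n.+1)%N.
Proof.
apply: leq_trans (size_poly_exp_leq _ _) _; rewrite ltnS.
suff: (size (u%:P + v%:P * 'X)%R <= 2)%N by nia.
by rewrite addrC size_MXaddC; case: ifP => // _; rewrite ltnS size_polyC_leq1.
Qed.

Lemma coef_affine_exp (B : nzRingType) (u v : B) n :
  ((u%:P + v%:P * 'X) ^+ n)`_n = v ^+ n.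
Proof.
elim: n => [|n IHn]; first by rewrite !expr0 coef1.
rewrite exprSr mulrDr coefD coefMC nth_default ?size_affine_exp // mul0r add0r.
by rewrite mulrA coefMX /= coefMC IHn exprSr.
Qed.

(** The map [r |-> g (u + r v)] is polynomial in [r] with coefficients in [A],
    and the coefficient of degree [n = deg g] is [lead_coef g *: v ^+ n]. Having
    infinitely many roots, this polynomial is zero. *)
Lemma annihilated_line_nilpotent (R : idomainType) (A : unitAlgType R)
    (g : {poly R}) (u v : A) :
  infinite_set [set: R]%classic -> torsion_free A -> g != 0 ->
  (forall r : R, horner_alg (u + r *: v) g = 0) -> v ^+ (size g).-1 = 0.
Proof.
move=> infR tfA g_neq0 g_line.
pose Q : {poly A} :=
  \sum_(i < size g) (g`_i)%:A *: (u%:P + v%:P * 'X) ^+ i.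
have Q_alg r : Q.[r%:A] = 0.
  rewrite -(g_line r) -[g in RHS]coefK poly_def linear_sum horner_sum.
  apply: eq_bigr => i _; rewrite hornerZ linearZ /= rmorphXn /= horner_algX.
  rewrite horner_exp_comm; last exact: comm_poly_alg.
  rewrite hornerD hornerC hornerCM hornerX.
  by rewrite mulr_algr.
have size_Q : (size Q <= size g)%N.
  apply: (leq_trans (size_sum _ _ _)); apply/bigmax_leqP => i _.
  by rewrite (leq_trans (size_scale_leq _ _)) //
    (leq_trans (size_affine_exp _ _ _ _)).
have Q0 : Q = 0.
  have [S _ le_S] := infinite_set_fset (size g) infR.
  have le_QS := leq_trans size_Q le_S.
  by apply: (root_alg_eq0 _ _ _ _ tfA (fset_uniq S) le_QS) => r _.
have g_size : (0 < size g)%N by rewrite size_poly_gt0.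
have: Q`_(size g).-1 = 0 by rewrite Q0 coef0.
rewrite /Q; case size_g: (size g) g_size => [//|n] _ /=.
(* Only the term of index [n] of [Q] reaches degree [n]. *)
rewrite coef_sum big_ord_recr /= big1 => [|i _]; last first.
  rewrite coefZ [X in _ * X]nth_default ?mulr0 //.
  exact: leq_trans (size_affine_exp _ _ _ _) (ltn_ord i).
rewrite add0r coefZ coef_affine_exp mulr_algl => /tfA[] // gn.
by case/eqP: g_neq0; apply/eqP; rewrite -lead_coef_eq0 /lead_coef size_g gn.
Qed.

Lemma unit_1D_sqr0 (B : unitRingType) (a : B) :
  a ^+ 2 = 0 -> 1 + a \is a GRing.unit.
Proof.
move=> a2; have a2' : a * a = 0 by rewrite -expr2.
apply/unitrP; exists (1 - a).
by split; rewrite mulrDl mulrDr ?mulrDr !mulr1 !mul1r ?mulrN ?mulNr a2' oppr0;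
  rewrite addr0 ?subrK ?addrK.
Qed.

Lemma expr_mulC_shift (B : nzRingType) (x y : B) n :
  (x * y) ^+ n.+1 = x * (y * x) ^+ n * y.
Proof.
elim: n => [|n IHn]; first by rewrite expr0 expr1 mulr1.
by rewrite exprSr IHn [(y * x) ^+ n.+1]exprSr !mulrA.
Qed.

(** Multiplication by [a] on the right absorbs the terms of [a * (1 + e)] without
    [e], since [a * (1 + e) * a = a * e * a]. *)
Lemma expr_mul1D_sqr0 (B : nzRingType) (a e : B) n :
  a ^+ 2 = 0 -> (a * (1 + e)) ^+ n * a = (a * e) ^+ n * a.
Proof.
move=> a2; elim: n => [|n IHn]; first by rewrite !expr0.
have -> : (a * (1 + e)) ^+ n.+1 * a = (a * (1 + e)) ^+ n * a * e * a.
  by rewrite exprSr -!mulrA mulrDl mul1r mulrDr -expr2 a2 add0r.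
by rewrite IHn exprSr !mulrA.
Qed.

Lemma word_eval_powers (B : unitRingType) m (u : B) (d : 'I_m -> nat)
    (w : free_group m) :
  u \is a GRing.unit ->
  word_eval (fun j => u ^+ d j) w = u ^ (\sum_j exponent_sum w j * (d j)%:Z).
Proof.
move=> u_unit; rewrite /word_eval /exponent_sum.
have -> : \sum_j (\sum_(l <- fgword w | l.1 == j) (-1) ^+ l.2) * (d j)%:Z
    = \sum_(l <- fgword w) (-1) ^+ l.2 * (d l.1)%:Z :> int.
  under eq_bigr do rewrite mulr_suml.
  rewrite (exchange_big_dep xpredT) //=; apply: eq_bigr => l _.
  by rewrite (big_pred1 l.1).
elim: (fgword w) => [|[j []] s IHs]; first by rewrite !big_nil.
  by rewrite !big_cons IHs exprzDr //= expr1 mulN1r -exprnN.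
by rewrite !big_cons IHs exprzDr //= expr0 mul1r.
Qed.

(** The sum below is the value at [M] of the polynomial whose coefficients are the
    exponent sums of [w]. This polynomial is nonzero, so it suffices to take for
    [M] a natural number that is not a root of the product over [w] in [s]. *)
Lemma exists_separating_powers m (s : seq (free_group m)) :
  (forall w, w \in s -> exists j, exponent_sum w j != 0) ->
  exists M : nat, forall w, w \in s ->
    \sum_j exponent_sum w j * ((M ^ j)%N)%:Z != 0.
Proof.
move=> s_neq0.
pose p (w : free_group m) : {poly int} :=
  \poly_(i < m) odflt 0 (omap (exponent_sum w) (insub i)).
have p_coef w (j : 'I_m) : (p w)`_j = exponent_sum w j.
  by rewrite coef_poly ltn_ord valK.
have p_neq0 : \prod_(w <- s) p w != 0.
  rewrite prodf_seq_neq0; apply/allP => w /s_neq0[j]; apply: contraNneq.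
  by rewrite -p_coef => ->; rewrite coef0.
pose rs := [seq i%:Z | i <- iota 0 (size (\prod_(w <- s) p w))].
have: ~~ all (root (\prod_(w <- s) p w)) rs.
  apply/negP=> /(max_poly_roots p_neq0).
  rewrite map_inj_uniq ?iota_uniq; last by move=> i j [].
  by rewrite size_map size_iota ltnn => /(_ isT).
case/allPn=> _ /mapP[M _ ->]; rewrite rootE horner_prod prodf_seq_neq0.
move=> /allP nroot; exists M => w /nroot; apply: contraNneq => /= pM.
apply/eqP; rewrite horner_poly -[RHS]pM; apply: eq_bigr => j _.
by rewrite valK /= -[(M ^ j)%N%:Z]natz natrX natz.
Qed.

(** Put [u ^+ (M ^ j)] for the variable [x_j], with [M] as in
    [exists_separating_powers]: a word [w] takes the value [u ^ e w], where
    [e w = 0] only for the trivial word. Multiplying by a large power [u ^+ K]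
    clears the negative exponents. Other words may cancel one another in the
    resulting polynomial [g], but its coefficient of degree [K] comes from the
    trivial word alone, and therefore [g] is nonzero. *)
Lemma LPI_units_algebraic (R : idomainType) (A : unitAlgType R) :
  units_satisfy_LPI A ->
  exists2 g : {poly R}, g != 0
    & forall u : A, u \is a GRing.unit -> horner_alg u g = 0.
Proof.
case=> m [P [_ [P1 _ P_exp] P_eval]].
have [M sepM] : exists M : nat, forall w,
    w \in [seq w <- msupp P | w != fg1 m] ->
    \sum_j exponent_sum w j * ((M ^ j)%N)%:Z != 0.
  apply: exists_separating_powers => w; rewrite mem_filter => /andP[w1 Pw].
  exact: P_exp.
pose e (w : free_group m) : int := \sum_j exponent_sum w j * ((M ^ j)%N)%:Z.
pose K := (\sum_(w <- msupp P) absz (e w))%N.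
pose k w := absz (e w + K%:Z).
have kE w : w \in msupp P -> (k w)%:Z = e w + K%:Z.
  move=> Pw; have: (absz (e w) <= K)%N.
    by rewrite /K (bigD1_seq w) ?fset_uniq //= leq_addr.
  rewrite /k; lia.
exists (\sum_(w <- msupp P) P@_w *: 'X^(k w)).
  have P1' : fg1 m \in msupp P by rewrite -mcoeff_neq0.
  have k1 : k (fg1 m) = K.
    rewrite /k /e big1 ?add0r // => j _.
    by rewrite /exponent_sum big_nil mul0r.
  apply: contra_neq P1 => /(congr1 (fun p : {poly R} => p`_K)).
  rewrite coef0 coef_sum (bigD1_seq (fg1 m)) ?fset_uniq //=.
  rewrite coefZ coefXn k1 eqxx mulr1 big_seq_cond big1 ?addr0 // => w.
  case/andP=> Pw w1; rewrite coefZ coefXn.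
  case: eqP => [Kk|]; last by rewrite mulr0.
  have /sepM/eqP[] : w \in [seq w <- msupp P | w != fg1 m].
    by rewrite mem_filter w1.
  by have := kE w Pw; rewrite -Kk => /eqP; rewrite -subr_eq subrr => /eqP.
move=> u u_unit; rewrite linear_sum /=.
have := P_eval (fun j => u ^+ (M ^ j)) (fun j => unitrX _ u_unit).
rewrite /laurent_eval => /(congr1 (fun x => x * u ^+ K)).
rewrite mul0r mulr_suml => Pu; rewrite -[RHS]Pu.
apply: eq_big_seq => w Pw; rewrite linearZ /= rmorphXn /= horner_algX.
rewrite mulr_algl -scalerAl word_eval_powers // -[u ^+ K]/(u ^ K%:Z) -exprzDr //.
by rewrite -kE.
Qed.

Theorem corollary2p2 (R : idomainType) (A : unitAlgType R)
    (R_infinite : infinite_set [set: R]%classic)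
    (A_torsion_free : torsion_free A)
    (A_LPI : units_satisfy_LPI A)
    (a b c : A) (a2 : a ^+ 2 = 0) (bc : b * c = 0) :
  right_ideal (principal_right_ideal (b * a * c)) /\
  nil_bounded_exponent (principal_right_ideal (b * a * c)).
Proof.
split.
  split=> [|_ _ [x ->] [y ->]|_ y [x ->]].
  - by exists 0; rewrite mulr0.
  - by exists (x - y); rewrite mulrBr.
  - by exists (x * y); rewrite mulrA.
have [g g_neq0 g_units] := LPI_units_algebraic _ _ A_LPI.
exists (size g).-1.+2 => _ [d ->]; exists (size g).-1.+2 => //.
set n := (size g).-1; pose e := c * d * b.
have e2 : e ^+ 2 = 0.
  by rewrite /e expr2 !mulrA -[c * d * b * c]mulrA bc mulr0 !mul0r.
have line_units (r : R) : 1 + e + r *: (a * (1 + e)) \is a GRing.unit.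
  have -> : 1 + e + r *: (a * (1 + e)) = (1 + r *: a) * (1 + e).
    by rewrite [RHS]mulrDl mul1r scalerAl.
  by rewrite unitrMr unit_1D_sqr0 // exprZn a2 scaler0.
have aen : (a * (1 + e)) ^+ n = 0.
  have nilp := annihilated_line_nilpotent _ _ _ _ _ R_infinite A_torsion_free.
  apply: (nilp _ _ _ g_neq0) => r.
  exact/g_units/line_units.
have -> : b * a * c * d = b * (a * c * d) by rewrite !mulrA.
rewrite expr_mulC_shift.
have -> : a * c * d * b = a * e by rewrite /e !mulrA.
by rewrite exprSr [_ * (a * e)]mulrA -expr_mul1D_sqr0 // aen !(mul0r, mulr0).
Qed.
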